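(* Let $\pi\in\mathbb{R}^n\setminus\{0\}$, $\pi_0<\pi_1$ real, and $F=\{(x,t)\in\mathbb{R}^{n+1}:\pi_0\le\pi^Tx\le\pi_1\}$. Let $A\in\mathbb{R}^{n\times n}$ be invertible, $c\in\mathbb{R}^n$, and $$K=\{(x,t)\in\mathbb{R}^{n+1}:\|A(x-c)\|_2\le t\}.$$ Let $a=\frac{\pi_1+\pi_0-2\pi^Tc}{\pi_1-\pi_0}$, $b=\frac{-2(\pi_1-\pi^Tc)(\pi_0-\pi^Tc)}{\pi_1-\pi_0}$, $\widehat A=\bigl(P^\perp_{A^{-T}\pi}+aP_{A^{-T}\pi}\bigr)A$, and $\widehat c=\frac{b}{\|A^{-T}\pi\|_2^2}A^{-T}\pi$. If $\pi^Tc\notin(\pi_0,\pi_1)$, then $\mathrm{conv}(K\setminus \mathrm{int}(F))=K$. Otherwise, $$\mathrm{conv}\bigl(K\setminus \mathrm{int}(F)\bigr)=K\cap C,\qquad C=\bigl\{(x,t)\in\mathbb{R}^{n+1}:\|\widehat A(x-c)+\widehat c\|_2\le t\bigr\}.$$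
   Context: For $v\in\mathbb{R}^n\setminus\{0\}$, $P_v=\frac{vv^T}{\|v\|_2^2}$ and $P_v^\perp=I-P_v$. $A^{-T}=(A^{-1})^T$. $\mathrm{int}$ is the topological interior and $\mathrm{conv}$ the convex hull. *)

(* Defs.v *)
From HB Require Import structures.
From mathcomp Require Import all_boot all_order all_algebra.
From mathcomp Require Import all_classical all_reals all_analysis.

Set Implicit Arguments.
Unset Strict Implicit.
Unset Printing Implicit Defensive.

Import Order.TTheory GRing.Theory Num.Theory.
Import numFieldNormedType.Exports.

Local Open Scope classical_set_scope.
Local Open Scope ring_scope.

Definition dotv (R : realType) (n : nat) (u v : 'cV[R]_n) : R :=
  (u^T *m v) 0 0.

(* The norm `|v| that the library puts on 'cV[R]_n is the sup norm, hence this
   separate Euclidean norm. *)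
Definition norm2 (R : realType) (n : nat) (v : 'cV[R]_n) : R :=
  Num.sqrt (\sum_(i < n) v i 0 ^+ 2).

Definition projmx (R : realType) (n : nat) (v : 'cV[R]_n) : 'M[R]_n :=
  (norm2 v ^+ 2)^-1 *: (v *m v^T).

Definition coprojmx (R : realType) (n : nat) (v : 'cV[R]_n) : 'M[R]_n :=
  1%:M - projmx v.


Definition conv_hull (R : realType) (E : lmodType R) (S : set E) : set E :=
  smallest (@convex_set R E) S.

(* Main.v *)
(* Put l = p^T (x - c), which ranges over (l0, l1) on the interior of F. If
   0 lies outside (l0, l1), a point of K in the strip lies between the apex
   (c, 0) of K and the point of K on the same ray with l = l0 or l = l1.
   Otherwise, in the coordinates A (x - c), the quadratic forms of C and K differ
   by ((a l + b)^2 - l^2) / |A^-T p|^2, which is a nonpositive multiple of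
   (l - l0) (l - l1): so C contains K outside the strip, and the two cones
   coincide on both bounding hyperplanes. *)
Require Import Defs.
From mathcomp Require Import all_boot all_order all_algebra.
From mathcomp Require Import all_classical all_reals all_analysis.
From mathcomp Require Import ring lra.
Import Order.TTheory GRing.Theory Num.Theory.
Import numFieldNormedType.Exports.
Local Open Scope classical_set_scope.
Local Open Scope ring_scope.

(** * Euclidean inner product and norm *)

Section Dot.
Context {R : realType} {n : nat}.
Implicit Types (u v w p : 'cV[R]_n) (r s t : R).

Lemma dotvE u v : dotv u v = \sum_i u i 0 * v i 0.
Proof. by rewrite /dotv mxE; under eq_bigr do rewrite mxE. Qed.

Lemma dotvC u v : dotv u v = dotv v u.
Proof. by rewrite !dotvE; apply: eq_bigr => i _; rewrite mulrC. Qed.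

Lemma dotvDr u v w : dotv u (v + w) = dotv u v + dotv u w.
Proof. by rewrite /dotv mulmxDr mxE. Qed.

Lemma dotvZr r u v : dotv u (r *: v) = r * dotv u v.
Proof. by rewrite /dotv -scalemxAr mxE. Qed.

Lemma dotvBr u v w : dotv u (v - w) = dotv u v - dotv u w.
Proof. by rewrite dotvDr -scaleN1r dotvZr mulN1r. Qed.

Lemma norm2_ge0 v : 0 <= norm2 v.
Proof. exact: sqrtr_ge0. Qed.

Lemma sqr_norm2 v : norm2 v ^+ 2 = dotv v v.
Proof.
rewrite /norm2 sqr_sqrtr ?sumr_ge0 // => [|i _]; last exact: sqr_ge0.
by rewrite dotvE; apply: eq_bigr => i _; rewrite expr2.
Qed.

Lemma dotvv_eq0 v : (dotv v v == 0) = (v == 0).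
Proof.
apply/eqP/eqP => [|->]; last by rewrite /dotv mulmx0 mxE.
rewrite dotvE => /eqP; rewrite psumr_eq0 => [/allP v0|i _]; last exact: sqr_ge0.
apply/colP => i; rewrite mxE; apply/eqP.
by have := v0 i (mem_index_enum i); rewrite mulf_eq0 orbb.
Qed.

Lemma norm2_gt0 v : (0 < norm2 v) = (v != 0).
Proof.
by rewrite lt_neqAle norm2_ge0 andbT eq_sym -(sqrf_eq0 (norm2 v)) sqr_norm2 dotvv_eq0.
Qed.

Lemma norm2_le v t : (norm2 v <= t) = (0 <= t) && (norm2 v ^+ 2 <= t ^+ 2).
Proof.
case: (leP 0 t) => [t0|t0] /=; first by rewrite ler_sqr // nnegrE norm2_ge0.
by apply/negbTE; rewrite -ltNge (lt_le_trans t0) ?norm2_ge0.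
Qed.

Lemma sqr_norm2_add r s u v :
  norm2 (r *: u + s *: v) ^+ 2 =
  r ^+ 2 * norm2 u ^+ 2 + 2 * r * s * dotv u v + s ^+ 2 * norm2 v ^+ 2.
Proof.
rewrite !sqr_norm2 dotvDr !dotvZr ![dotv (_ + _) _]dotvC !dotvDr !dotvZr.
by rewrite (dotvC v u); ring.
Qed.

Lemma norm2Z r v : 0 <= r -> norm2 (r *: v) = r * norm2 v.
Proof.
move=> r0; apply: (@pexpIrn _ 2) => //; rewrite ?nnegrE ?norm2_ge0 //.
  by rewrite mulr_ge0 ?norm2_ge0.
have := sqr_norm2_add r 0 v 0; rewrite scaler0 addr0 => ->.
by rewrite expr0n /= !(mul0r, mulr0, addr0) exprMn.
Qed.

Lemma dotv_le_norm2 u v : dotv u v <= norm2 u * norm2 v.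
Proof.
have [->|u0] := eqVneq u 0.
  by rewrite dotvE big1 ?mulr_ge0 ?norm2_ge0 // => i _; rewrite mxE mul0r.
have [->|v0] := eqVneq v 0.
  by rewrite dotvE big1 ?mulr_ge0 ?norm2_ge0 // => i _; rewrite mxE mulr0.
have uv0 : 0 < norm2 u * norm2 v by rewrite mulr_gt0 ?norm2_gt0.
(* This square equals 2 |u| |v| (|u| |v| - u . v). *)
have := sqr_ge0 (norm2 (norm2 v *: u + (- norm2 u) *: v)).
rewrite sqr_norm2_add => h; rewrite -subr_ge0 -(pmulr_rge0 _ uv0).
by move: h; set d := dotv u v; set x := norm2 u; set y := norm2 v => h; nra.
Qed.

Lemma norm2D u v : norm2 (u + v) <= norm2 u + norm2 v.
Proof.
rewrite norm2_le addr_ge0 ?norm2_ge0 //=.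
rewrite -[u in norm2 (u + _)]scale1r -[v in norm2 (_ + v)]scale1r sqr_norm2_add.
by have := dotv_le_norm2 u v; lra.
Qed.

(** * Topology of the strip and convexity of the cones *)

Lemma continuous_dotv_fst p : continuous (fun z : 'cV[R]_n * R^o => dotv p z.1 : R).
Proof.
rewrite (_ : (fun _ => _) = fun z : 'cV[R]_n * R^o => \sum_i p i 0 * z.1 i 0).
  move=> z; apply: cvg_big => [|i _]; first exact: add_continuous.
apply: cvgM; first exact: cvg_cst.
apply: (@continuous_comp _ _ _ fst (fun M : 'cV[R]_n => M i 0)).
  exact: cvg_fst.
exact: coord_continuous.
by apply/funext => z; rewrite dotvE.
Qed.

(** The open strip is the preimage of an open interval under a continuous map. Conversely, an
    interior point can be moved slightly along both [p] and [- p], which changes [dotv p z.1] by a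
    nonzero amount either way, so both bounds are strict. *)
Lemma interior_strip p (p0 p1 : R) : p != 0 ->
  interior [set z : 'cV[R]_n * R^o | p0 <= dotv p z.1 <= p1] =
  [set z | p0 < dotv p z.1 < p1].
Proof.
move=> p_neq0; apply/seteqP; split=> [z zF|]; last first.
  rewrite -open_subsetE => [z /andP[/ltW h0 /ltW h1]|]; first by apply/andP.
  rewrite (_ : [set z | _] =
      (fun z : 'cV[R]_n * R^o => dotv p z.1) @^-1` `]p0, p1[%classic).
    apply: open_comp => [z _|]; last exact: interval_open.
    exact: continuous_dotv_fst.
  by apply/seteqP; split=> z /=; rewrite in_itv.
have cvgz : ((z.1 + s *: p, z.2) : 'cV[R]_n * R^o) @[s --> (0 : R)] --> z.
  have cvg1 : (z.1 + s *: p) @[s --> (0 : R)] --> z.1 + 0 *: p.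
    by apply: cvgD; [exact: cvg_cst | apply: cvgZr_tmp; exact: cvg_id].
  rewrite scale0r addr0 in cvg1.
  rewrite [X in _ --> X]surjective_pairing.
  by apply: (@cvg_pair _ _ _ _ (nbhs z.1) (nbhs z.2)) => //; exact: cvg_cst.
have /nbhs_ballP[e /= e0 eF] := cvgz _ zF.
have bnd s : `|s| < e -> p0 <= dotv p z.1 + s * norm2 p ^+ 2 <= p1.
  move=> se; have := eF s; rewrite -ball_normE /= sub0r normrN => /(_ se).
  by rewrite dotvDr dotvZr sqr_norm2.
have pp : 0 < norm2 p ^+ 2 by rewrite exprn_gt0 ?norm2_gt0.
have e2 : `|e / 2| < e by rewrite gtr0_norm; lra.
have /andP[_ h1] := bnd _ e2.
have /andP[h0 _] : p0 <= dotv p z.1 + - (e / 2) * norm2 p ^+ 2 <= p1.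
  by apply: bnd; rewrite normrN.
have : 0 < e / 2 * norm2 p ^+ 2 by rewrite mulr_gt0 ?divr_gt0.
by move: h0 h1; rewrite mulNr /= => *; apply/andP; split; lra.
Qed.

(** The map inside the norm is affine, so the triangle inequality suffices. Serves both cones:
    [d = 0] for [K], the shift by a multiple of [u] for [C]. *)
Lemma convex_set_cone (M : 'M[R]_n) (c d : 'cV[R]_n) :
  @convex_set R ('cV[R]_n * R^o)%type
    [set z | norm2 (M *m (z.1 - c) + d) <= z.2].
Proof.
move=> x y l; rewrite !inE /= => hx hy.
pose t : R := l%:num; have t0 : 0 <= t by rewrite /t ge0.
have t1 : 0 <= 1 - t by rewrite subr_ge0 /t le1.
rewrite -[X in norm2 X <= _](_ : t *: (M *m (x.1 - c) + d) +
   (1 - t) *: (M *m (y.1 - c) + d) = _); last first.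
  rewrite !scalerDr !scalemxAr addrACA -(scalerDl d) (addrC t) subrK scale1r -mulmxDr.
  congr (_ *m _ + _); rewrite !scalerBr addrACA -opprD -scalerDl.
  by rewrite (addrC t) subrK scale1r.
apply: le_trans (norm2D _ _) _; rewrite !norm2Z //.
rewrite [leRHS](_ : _ = t * x.2 + (1 - t) * y.2) //.
by apply: lerD; rewrite ler_wpM2l.
Qed.

End Dot.

Lemma conv_hull_segment {R : realType} {E : lmodType R} (S : set E) (x y : E) (t : R) :
  S x -> S y -> 0 <= t <= 1 -> conv_hull S (t *: x + (1 - t) *: y).
Proof.
move=> Sx Sy /andP[t0 t1] D [cD SD].
by have := cD x y (Itv01 t0 t1); rewrite !inE; apply; exact: SD.
Qed.

Lemma conv_hull_eq {R : realType} {E : lmodType R} (S T : set E) :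
  @convex_set R E T -> S `<=` T -> T `<=` conv_hull S -> conv_hull S = T.
Proof. by move=> cT ST Tc; apply/seteqP; split=> //; exact: smallest_sub. Qed.

(** * The strip and the two cones in the coordinates A (x - c) *)

Section SplitCut.
Context {R : realType} {n : nat}.
Variables (A : 'M[R]_n) (p c : 'cV[R]_n) (p0 p1 : R).
Hypotheses (hp : p != 0) (hp01 : p0 < p1) (hA : A \in unitmx).

(** The normal of the strip in the coordinates A (x - c). *)
Let u := (invmx A)^T *m p.
Let l0 := p0 - dotv p c.
Let l1 := p1 - dotv p c.
(** [a * l + b] is the affine function of [l] with value [l1] at [l1] and [- l0] at [l0]. *)
Let a := (l1 + l0) / (l1 - l0).
Let b := (- 2 * l1 * l0) / (l1 - l0).

Let F := [set z : 'cV[R]_n * R^o | p0 <= dotv p z.1 <= p1].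
Let K := [set z : 'cV[R]_n * R^o | norm2 (A *m (z.1 - c)) <= z.2].
Let C := [set z : 'cV[R]_n * R^o |
  norm2 ((coprojmx u + a *: projmx u) *m A *m (z.1 - c) +
         (b / norm2 u ^+ 2) *: u) <= z.2].

Let l01 : l0 < l1. Proof. by rewrite ltrD2r. Qed.
Let d_neq0 : l1 - l0 != 0. Proof. by rewrite subr_eq0 gt_eqF. Qed.

Lemma dotv_invtr_mul v : dotv u (A *m v) = dotv p v.
Proof.
by rewrite /u /dotv trmx_mul trmxK mulmxA -[_ *m _ *m A]mulmxA mulVmx // mulmx1.
Qed.

Lemma norm2_invtr_gt0 : 0 < norm2 u.
Proof.
rewrite norm2_gt0; apply: contraNneq hp => u0; rewrite -dotvv_eq0.
by rewrite -dotv_invtr_mul u0 /dotv trmx0 mul0mx mxE.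
Qed.

Let N_neq0 : norm2 u != 0. Proof. by rewrite gt_eqF ?norm2_invtr_gt0. Qed.

Lemma notin_interior_strip (z : 'cV[R]_n * R^o) :
  ~ interior F z <-> (dotv p (z.1 - c) <= l0) || (l1 <= dotv p (z.1 - c)).
Proof.
rewrite interior_strip // /l0 /l1 dotvBr lerD2r lerD2r /=.
by rewrite 2!leNgt -negb_and; split=> /negP.
Qed.

(** The map keeps the part of [A *m x] orthogonal to [u] and turns the inner product with [u] from
    [l] into [a * l + b]; only that term of the squared norm changes. *)
Lemma norm2_hat (x : 'cV[R]_n) :
  norm2 ((coprojmx u + a *: projmx u) *m A *m x + (b / norm2 u ^+ 2) *: u) ^+ 2 =
  norm2 (A *m x) ^+ 2 + ((a * dotv p x + b) ^+ 2 - dotv p x ^+ 2) / norm2 u ^+ 2.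
Proof.
set y := A *m x.
have -> : (coprojmx u + a *: projmx u) *m A *m x + (b / norm2 u ^+ 2) *: u =
    1 *: y + (((a - 1) * dotv p x + b) / norm2 u ^+ 2) *: u.
  have uuy : u *m u^T *m y = dotv p x *: u.
    rewrite -mulmxA -dotv_invtr_mul -/y [u^T *m y]mx11_scalar.
    by rewrite mul_mx_scalar.
  rewrite -mulmxA -/y /coprojmx /projmx mulmxDl mulmxBl mul1mx -!scalemxAl uuy.
  rewrite scale1r !scalerA -!addrA; congr (_ + _).
  by rewrite -scaleNr -!scalerDl; congr (_ *: _); field.
rewrite sqr_norm2_add (dotvC _ u) dotv_invtr_mul.
by field.
Qed.

(** The squares agree at [l0] and [l1], so the difference is a multiple of the product of the two
    linear factors; the coefficient is [a ^+ 2 - 1]. *)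
Let hat_sub l : (a * l + b) ^+ 2 - l ^+ 2 =
  4 * l0 * l1 / (l1 - l0) ^+ 2 * ((l - l0) * (l - l1)).
Proof. by rewrite /a /b; field. Qed.

(** * The convex hull for the two positions of the apex *)

Lemma conv_hull_outside_strip : (0 <= l0) || (l1 <= 0) ->
  conv_hull (K `\` interior F) = K.
Proof.
move=> l0l1; apply: conv_hull_eq; [|by move=> z []|].
  by rewrite (_ : K = [set z | norm2 (A *m (z.1 - c) + 0) <= z.2]);
    [exact: convex_set_cone | apply/seteqP; split=> z /=; rewrite addr0].
move=> z Kz; have [Fz|] := pselect (interior F z); last first.
  by move=> Fz; apply: sub_gen_smallest.
set l := dotv p (z.1 - c).
have : ~~ ((l <= l0) || (l1 <= l)).
  by apply/negP => /notin_interior_strip.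
rewrite negb_or -!ltNge => /andP[l0l ll1].
(* [m] is the bounding value farther from 0; the ray from the apex through [z] reaches it after
   scaling by the inverse of [s]. *)
have [m [s [m01 s01 sm]]] : exists m s, [/\ m = l0 \/ m = l1, 0 < s <= 1 & s * m = l].
  case/orP: l0l1 => h.
    have l10 : 0 < l1 by lra.
    exists l1, (l / l1); split; [by right| |by field; lra].
    by rewrite ler_pdivrMr ?divr_gt0 ?mul1r ?ltW//; lra.
  have l00 : 0 < - l0 by lra.
  exists l0, (- l / - l0); split; [by left| |by field; lra].
  by rewrite ler_pdivrMr ?divr_gt0 ?mul1r//; lra.
have [s0 s1] := andP s01.
have -> : z = s *: (c + s^-1 *: (z.1 - c), s^-1 * z.2 : R^o) + (1 - s) *: (c, 0 : R^o).
  rewrite [LHS]surjective_pairing; congr (_, _) => /=.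
    rewrite scalerDr scalerA divff ?gt_eqF // scale1r scalerBl scale1r.
    by rewrite addrC addrA subrK addrC subrK.
  by rewrite scaler0 addr0 -[RHS]/(s * (s^-1 * z.2)) mulVKf // gt_eqF.
apply: conv_hull_segment; last by rewrite ltW.
  split; rewrite /K /=.
    rewrite addrAC subrr add0r -scalemxAr norm2Z ?ler_pM2l ?invr_gt0 //.
    by rewrite invr_ge0 ltW.
  apply: (notin_interior_strip _).2; rewrite /= addrAC subrr add0r dotvZr -/l -sm mulKf ?gt_eqF //.
  by case: m01 => ->; rewrite lexx ?orbT.
split; first by rewrite /K /= subrr mulmx0 -(scale0r (0 : 'cV_n)) norm2Z ?mul0r.
(* At the apex [l] is 0, so the claim is the hypothesis on [l0] and [l1]. *)
by apply: (notin_interior_strip _).2; rewrite /= subrr -(scale0r (0 : 'cV_n)) dotvZr mul0r.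
Qed.

(* The line through a point of [C] and the apex of [C] (parallel to the axis of
   [C] when [a = 0]) stays in [C] between the two bounding hyperplanes, since
   [a * l + b > 0] for [l0 <= l <= l1]. Along it [a * l + b] scales by [k], so
   that [l] becomes [l1] at [k = l1 / q] and [l0] at [k = - l0 / q]. *)
Lemma conv_hull_across_strip : l0 < 0 < l1 ->
  conv_hull (K `\` interior F) = K `&` C.
Proof.
case/andP=> l00 l10; apply: conv_hull_eq.
- move=> x y t; rewrite !inE => -[Kx Cx] [Ky Cy].
  split; last by apply/set_mem/convex_set_cone; apply/mem_set.
  have := @convex_set_cone R n A c 0 x y t.
  by rewrite !inE /= !addr0; apply.
- move=> z [Kz /notin_interior_strip Fz]; split=> //.
  move: Kz; rewrite /K /C /= !norm2_le norm2_hat => /andP[-> /=]; apply: le_trans.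
  rewrite gerDl hat_sub pmulr_lle0 ?invr_gt0 ?exprn_gt0 ?norm2_invtr_gt0 //.
  have : 0 <= (dotv p (z.1 - c) - l0) * (dotv p (z.1 - c) - l1).
    by case/orP: Fz => ?; nra.
  apply: mulr_le0_ge0; rewrite pmulr_lle0 ?invr_gt0 ?exprn_gt0 ?subr_gt0 //.
  by nra.
move=> z [Kz Cz]; have [Fz|] := pselect (interior F z); last first.
  by move=> Fz; apply: sub_gen_smallest.
set l := dotv p (z.1 - c).
have : ~~ ((l <= l0) || (l1 <= l)).
  by apply/negP => /notin_interior_strip.
rewrite negb_or -!ltNge => /andP[l0l ll1].
pose q := a * l + b.
have d0 : 0 < l1 - l0 by rewrite subr_gt0.
(* [q] interpolates between the positive values [- l0] and [l1]. *)
have qE : q = (l1 * (l - l0) - l0 * (l1 - l)) / (l1 - l0).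
  by rewrite /q /a /b; field.
have q0 : 0 < q by rewrite qE divr_gt0 //; nra.
have q_neq0 : q != 0 by rewrite gt_eqF.
(* Moving along [e] raises [l] at unit rate and shifts A (x - c) along [u] only. *)
have [e pe Ae] : exists2 e, dotv p e = 1 & A *m e = (norm2 u ^+ 2)^-1 *: u.
  exists ((norm2 u ^+ 2)^-1 *: (invmx A *m u)).
    rewrite dotvZr -dotv_invtr_mul mulmxA mulmxV // mul1mx -sqr_norm2.
    by rewrite mulVf ?expf_neq0.
  by rewrite -scalemxAr mulmxA mulmxV // mul1mx.
(* Scale [z] by [k] about the apex of [K], then correct along [e] to bring [l] to [m]. *)
pose pt k m : 'cV[R]_n * R^o := (c + (k *: (z.1 - c) + (m - k * l) *: e), k * z.2 : R).
have ptP k m : 0 <= k -> m ^+ 2 = (k * q) ^+ 2 -> m = l0 \/ m = l1 ->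
    (K `\` interior F) (pt k m).
  move=> k0 mkq m01; split; rewrite /K /=; last first.
    apply: (notin_interior_strip _).2; rewrite /= addrAC subrr add0r dotvDr !dotvZr pe -/l.
    by rewrite mulr1 addrC subrK; case: m01 => ->; rewrite lexx ?orbT.
  move: Cz; rewrite /C /= !norm2_le norm2_hat -/l -/q => /andP[z0 zq].
  rewrite mulr_ge0 //= addrAC subrr add0r mulmxDr -!scalemxAr Ae scalerA.
  rewrite sqr_norm2_add (dotvC _ u) dotv_invtr_mul -/l [(k * z.2) ^+ 2]exprMn.
  (* The form of [K] at [pt k m] is [k ^+ 2] times the form of [C] at [z], plus a term that vanishes
     when [m] is [k * q] up to sign. *)
  have -> : k ^+ 2 * norm2 (A *m (z.1 - c)) ^+ 2 +
      2 * k * ((m - k * l) / norm2 u ^+ 2) * l +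
      ((m - k * l) / norm2 u ^+ 2) ^+ 2 * norm2 u ^+ 2 =
      k ^+ 2 * (norm2 (A *m (z.1 - c)) ^+ 2 + (q ^+ 2 - l ^+ 2) / norm2 u ^+ 2) +
      (m ^+ 2 - (k * q) ^+ 2) / norm2 u ^+ 2 by field.
  by rewrite mkq subrr mul0r addr0 ler_wpM2l ?sqr_ge0.
(* With this weight the levels [l1], [l0] average to [l], and [l1], [- l0] average to [q], so the
   scale factors average to 1. *)
pose t := (l - l0) / (l1 - l0).
have kE : t * (l1 / q) + (1 - t) * (- l0 / q) = 1.
  apply: (mulIf q_neq0); rewrite mul1r [in RHS]qE /t; field.
  by rewrite d_neq0 q_neq0.
have mE : t * l1 + (1 - t) * l0 = l by rewrite /t; field.
have -> : z = t *: pt (l1 / q) l1 + (1 - t) *: pt (- l0 / q) l0.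
  rewrite [LHS]surjective_pairing; congr (_, _) => /=.
    rewrite [RHS](_ : _ = c + (t * (l1 / q) + (1 - t) * (- l0 / q)) *: (z.1 - c) +
        (t * l1 + (1 - t) * l0 - (t * (l1 / q) + (1 - t) * (- l0 / q)) * l) *: e).
      by rewrite kE mE mul1r subrr scale0r scale1r addr0 addrC subrK.
    by apply/colP => i; rewrite !mxE; ring.
  rewrite -[RHS]/(t * (l1 / q * z.2) + (1 - t) * (- l0 / q * z.2)).
  transitivity ((t * (l1 / q) + (1 - t) * (- l0 / q)) * z.2 : R); last by ring.
  by rewrite kE mul1r.
apply: conv_hull_segment.
- by apply: ptP; [rewrite divr_ge0 ?ltW | rewrite divfK ?gt_eqF | right].
- apply: ptP; [|rewrite divfK ?gt_eqF ?sqrrN // | by left].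
  by rewrite divr_ge0 ?ltW // oppr_gt0.
- by rewrite /t divr_ge0 ?ler_pdivrMr ?mul1r ?ltW //; lra.
Qed.

End SplitCut.

Theorem corollary4p2 (R : realType) (n : nat) (p : 'cV[R]_n) (p0 p1 : R)
    (A : 'M[R]_n) (c : 'cV[R]_n)
    (hp : p != 0) (hp01 : p0 < p1) (hA : A \in unitmx) :
  let F := [set z : 'cV[R]_n * R^o | p0 <= dotv p z.1 <= p1] in
  let K := [set z : 'cV[R]_n * R^o | norm2 (A *m (z.1 - c)) <= z.2] in
  let a := (p1 + p0 - 2 * dotv p c) / (p1 - p0) in
  let b := (- 2 * (p1 - dotv p c) * (p0 - dotv p c)) / (p1 - p0) in
  let u := (invmx A)^T *m p in
  let Ahat := (coprojmx u + a *: projmx u) *m A in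
  let chat := (b / norm2 u ^+ 2) *: u in
  let C := [set z : 'cV[R]_n * R^o |
              norm2 (Ahat *m (z.1 - c) + chat) <= z.2] in
  (dotv p c \notin `]p0, p1[ -> conv_hull (K `\` interior F) = K) /\
  (dotv p c \in `]p0, p1[ -> conv_hull (K `\` interior F) = K `&` C).
Proof.
move=> F K a b u Ahat chat C; split; rewrite in_itv /= => pc.
  apply: conv_hull_outside_strip => //.
  by rewrite subr_ge0 subr_le0 -[dotv p c <= p0]negbK -ltNge -[p1 <= _]negbK -ltNge -negb_and.
rewrite conv_hull_across_strip // ?subr_lt0 ?subr_gt0 // /C /Ahat /chat.
(* The shift by [dotv p c] cancels in the denominators. *)
rewrite (_ : a = (p1 - dotv p c + (p0 - dotv p c)) / (p1 - dotv p c - (p0 - dotv p c))).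
  by rewrite (_ : b = (- 2 * (p1 - dotv p c) * (p0 - dotv p c)) / (p1 - dotv p c - (p0 - dotv p c))) // /b;
    congr (_ / _); ring.
by rewrite /a; congr (_ / _); ring.
Qed.
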